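(* Every finite nilpotent DRR-detecting group is a $p$-group (for some prime $p$).
   Context: For a subset $S$ of a finite group $G$, the Cayley digraph $\mathrm{Cay}(G,S)$ has vertex set $G$ and a directed edge from $g_1$ to $g_2$ iff $g_2 = s g_1$ for some $s \in S$. $\mathrm{Aut}(G,S) = \{\varphi \in \mathrm{Aut}(G) : \varphi(S) = S\}$. A digraph $\Gamma$ is a DRR of $G$ if $\mathrm{Aut}(\Gamma) \cong G$ and acts regularly on the vertices. $G$ is DRR-detecting if for every subset $S \subseteq G$, $\mathrm{Aut}(G,S)=\{1\}$ implies $\mathrm{Cay}(G,S)$ is a DRR. *)

(* Defs.v *)
From HB Require Import structures.
From mathcomp Require Import all_boot all_order all_algebra all_fingroup all_solvable.

Set Implicit Arguments.
Unset Strict Implicit.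
Unset Printing Implicit Defensive.

Local Open Scope group_scope.

(* A digraph is a pair (V, e) of a vertex set V and an edge relation e (loops
   are allowed).  As with the library's Aut for groups, a permutation of V is
   encoded as a permutation of the ambient type that fixes every point
   outside V. *)
Definition digraph_aut (T : finType) (V : {set T}) (e : rel T) :
    {set {perm T}} :=
  [set f : {perm T} | perm_on V f
     & [forall x in V, forall y in V, e (f x) (f y) == e x y]].

Lemma digraph_aut_group_set (T : finType) (V : {set T}) (e : rel T) :
  group_set (digraph_aut V e).
Proof.
apply/group_setP; split.
  rewrite inE perm_on1; apply/forall_inP => x _; apply/forall_inP => y _.
  by rewrite !perm1.
move=> f g; rewrite !inE => /andP[fV /forall_inP fe] /andP[gV /forall_inP ge].
rewrite perm_onM //; apply/forall_inP => x xV; apply/forall_inP => y yV.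
rewrite !permM.
have fxV : f x \in V by rewrite perm_closed.
have fyV : f y \in V by rewrite perm_closed.
have /forall_inP/(_ _ fyV)/eqP-> := ge _ fxV.
exact: (forall_inP (fe _ xV)).
Qed.

Canonical digraph_aut_group (T : finType) (V : {set T}) (e : rel T) :=
  Group (digraph_aut_group_set V e).

Definition acts_regularly (T : finType) (A : {set {perm T}}) (V : {set T}) :
    Prop :=
  [transitive A, on V | 'P] /\ {in V, forall x, 'C_A[x | 'P] = 1}.

(* The edge relation of Cay(G, S); its vertex set is G. *)
Definition cayley_rel (gT : finGroupType) (S : {set gT}) : rel gT :=
  fun g1 g2 => [exists s in S, g2 == s * g1].

Definition aut_set (gT : finGroupType) (G S : {set gT}) : {set {perm gT}} :=
  [set phi in Aut G | phi @: S == S].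

Definition is_DRR (gT : finGroupType) (G : {group gT}) (e : rel gT) : Prop :=
  digraph_aut G e \isog G /\ acts_regularly (digraph_aut G e) G.

Definition DRR_detecting (gT : finGroupType) (G : {group gT}) : Prop :=
  forall S : {set gT}, S \subset G ->
    aut_set G S = 1 -> is_DRR G (cayley_rel S).

(* Main.v *)
(** Write the nilpotent group as G = A * B with A and B nontrivial of coprime
orders and A generated by at most as many elements as B; then every automorphism
of G preserves A and B.  Let B_0 be generated by all but the last element of a
minimal generating sequence b_0, ..., b_(d-1) of B.  A subset S of G assigns to
each x in B a fiber F(x) in A.  If all fibers over B \ B_0 are full or empty,
then right multiplication by an element of A on the proper subgroup A * B_0,
extended by the identity, is an automorphism of Cay(G, S), which is therefore not
a DRR.  On the other hand the fibers can be chosen so that no nontrivial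
automorphism of G preserves S: b_(d-1) is recognized by its full fiber, b_0 by
a fiber A \ {a_0}, the other b_i by singletons {a_i}, and the order of the b_i by
marking the products b_i * b_(i+1) with the fiber A \ {1}; the elements a_i
generate A.  The only degenerate case is |A| = 2, where the fiber over b_0 is a
singleton as well; marking the inverse of b_0 too then singles out b_0, because
B has odd order. *)

Require Import Defs.
From mathcomp Require Import all_boot all_order all_algebra all_fingroup all_solvable.

Set Implicit Arguments.
Unset Strict Implicit.
Unset Printing Implicit Defensive.

Local Open Scope group_scope.

(** * Cayley digraphs with a non-regular automorphism group *)

Lemma cayley_relE (gT : finGroupType) (S : {set gT}) (x y : gT) :
  cayley_rel S x y = (y * x^-1 \in S).
Proof.
apply/exists_inP/idP => [[s sS /eqP->]|yxS]; first by rewrite mulgK.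
by exists (y * x^-1); rewrite ?mulgKV.
Qed.

(* The witness is right multiplication by an element of K on H, extended by the
   identity outside H. *)
Lemma wreath_not_DRR (gT : finGroupType) (G H K : {group gT}) (S : {set gT}) :
    H \proper G -> K \subset H -> K <| G -> K :!=: 1 ->
    {in G :\: H & K, forall s k, (k * s \in S) = (s \in S)} ->
  ~ is_DRR G (cayley_rel S).
Proof.
move=> /properP[sHG [z zG zH]] sKH /andP[_ nKG] ntK SK [_ [_ reg]].
have [k kK k1] := trivgPn _ ntK.
have kH := subsetP sKH k kK.
pose f x := if x \in H then x * k else x.
have fH x : (f x \in H) = (x \in H).
  by rewrite /f; case: (boolP (x \in H)) => [xH|/negPf//]; rewrite groupM.
have injf : injective f.
  move=> x y eqf; have := fH x; rewrite eqf fH => eqH.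
  by move: eqf; rewrite /f eqH; case: ifP => // _ /mulIg.
(* If exactly one of two vertices is in [H], their quotient is outside [H]. Right multiplication of
   [v] by [k'] multiplies [v * u^-1] on the left by a conjugate of [k'], which stays in [K] by
   normality. *)
have KS u v k' : u \in G -> v \in G -> v * u^-1 \notin H -> k' \in K ->
    (k' ^ v^-1 * (v * u^-1) \in S) = (v * u^-1 \in S).
  move=> uG vG uvH k'K; apply: SK; first by apply/setDP; rewrite groupM ?groupV.
  by rewrite memJ_norm ?groupV // (subsetP nKG).
have fP : perm injf \in digraph_aut G (cayley_rel S).
  rewrite inE; apply/andP; split.
    apply/subsetP => x; rewrite inE permE /f; case: ifPn => [xH _|].
      exact: (subsetP sHG).
    by rewrite eqxx.
  apply/forall_inP => x xG; apply/forall_inP => y yG.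
  rewrite !permE !cayley_relE /f; apply/eqP.
  case: (boolP (x \in H)) => xH; case: (boolP (y \in H)) => yH //.
  - by rewrite invMg mulgA mulgK.
  - have yxH : y * x^-1 \notin H by rewrite groupMr ?groupV.
    rewrite -(KS _ _ k^-1 xG yG yxH) ?groupV //.
    by congr (_ \in S); rewrite invMg conjgE invgK !mulgA mulgKV.
  - have yxH : y * x^-1 \notin H by rewrite groupMl ?groupV.
    rewrite -(KS _ _ k xG yG yxH) //.
    by congr (_ \in S); rewrite conjgE invgK !mulgA mulgKV.
(* The automorphism fixes [z], so regularity would make it trivial, but it sends 1 to [k]. *)
have : perm injf \in 'C_(digraph_aut G (cayley_rel S))[z | 'P].
  by apply/setIP; split=> //; apply/astab1P; rewrite /= apermE permE /f (negPf zH).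
rewrite (reg z zG) inE => /eqP/permP/(_ 1).
by rewrite permE perm1 /f group1 mul1g => /eqP; rewrite (negPf k1).
Qed.

(** * Irredundant generating sequences *)

Lemma eq_on_gen (gT : finGroupType) (G : {group gT}) (E : {set gT})
    (f : {morphism G >-> gT}) :
  E \subset G -> {in E, forall x, f x = x} -> {in <<E>>, forall x, f x = x}.
Proof.
move=> sEG fE x.
have gF : group_set [set y in G | f y == y].
  apply/group_setP; split=> [|y z]; first by rewrite inE group1 morph1 eqxx.
  rewrite !inE => /andP[yG /eqP fy] /andP[zG /eqP fz].
  by rewrite groupM // morphM // fy fz eqxx.
have: <<E>> \subset Group gF.
  rewrite gen_subG; apply/subsetP=> y yE.
  by rewrite inE (subsetP sEG) // fE /=.
by move=> /subsetP/[apply]; rewrite inE => /andP[_ /eqP].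
Qed.

(** The set of entries forgets repetitions, so [uniq] is always a separate condition. *)
Definition irredundant {gT : finGroupType} (s : seq gT) :=
  {in s, forall x, x \notin <<[set y in s] :\ x>>}.

Lemma mem_gen_others (gT : finGroupType) (s : seq gT) (x y : gT) :
  y \in s -> y != x -> y \in <<[set z in s] :\ x>>.
Proof. by move=> ys yx; rewrite mem_gen // !inE yx. Qed.

Lemma irredundant_neq1 (gT : finGroupType) (s : seq gT) (x : gT) :
  irredundant s -> x \in s -> x != 1.
Proof. by move=> irr /irr; apply: contraNneq => ->. Qed.

(** One of [x], [y] differs from [z]; equality would express it through the other entries. With [w]
    equal to 1, an entry or the inverse of one, this separates the edge products from the other
    marked elements. *)
Lemma irredundant_mulN (gT : finGroupType) (s : seq gT) (x y z w : gT) :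
    irredundant s -> x \in s -> y \in s -> z \in s -> x != y -> w \in <[z]> ->
  x * y != w.
Proof.
move=> irr xs ys zs xy; rewrite -cycle_subG => wz; apply/eqP => eqw.
have wM u : z != u -> w \in <<[set v in s] :\ u>>.
  by move=> zu; rewrite -cycle_subG (subset_trans wz) // cycle_subG mem_gen_others.
have xMy := mem_gen_others xs xy.
have yMx : y \in <<[set v in s] :\ x>> by rewrite mem_gen_others // eq_sym.
have [zx | zx] := eqVneq z x.
  have := wM y; rewrite zx => /(_ xy).
  by rewrite -eqw (groupMl _ xMy) (negPf (irr y ys)).
by have := wM x zx; rewrite -eqw (groupMr _ yMx) (negPf (irr x xs)).
Qed.

(** If [x] were neither [z] nor [t], the other entries would generate it; likewise for [y]. Only the
    unordered pair is recovered, since entries may commute. *)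
Lemma irredundant_mulI (gT : finGroupType) (s : seq gT) (x y z t : gT) :
    irredundant s -> x \in s -> y \in s -> z \in s -> t \in s -> x != y ->
  x * y = z * t -> (x = z /\ y = t) \/ (x = t /\ y = z).
Proof.
move=> irr xs ys zs ts xy eqM.
have xMy := mem_gen_others xs xy.
have yMx : y \in <<[set v in s] :\ x>> by rewrite mem_gen_others // eq_sym.
have xzt : x \in [:: z; t].
  apply: contraT; rewrite !inE negb_or => /andP[xz xt].
  have: x * y \in <<[set v in s] :\ x>>.
    by rewrite eqM groupM // mem_gen_others // eq_sym.
  by rewrite (groupMr _ yMx) (negPf (irr x xs)).
have yzt : y \in [:: z; t].
  apply: contraT; rewrite !inE negb_or => /andP[yz yt].
  have: x * y \in <<[set v in s] :\ y>>.
    by rewrite eqM groupM // mem_gen_others // eq_sym.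
  by rewrite (groupMl _ xMy) (negPf (irr y ys)).
move: xzt yzt xy; rewrite !inE.
by move=> /orP[]/eqP-> /orP[]/eqP->; rewrite ?eqxx //; [left | right].
Qed.

(* The consecutive pairs form a path graph on s whose automorphism f fixes its
   first vertex. *)
Lemma path_rigid (gT : finGroupType) (s : seq gT) (f : gT -> gT) :
    uniq s -> irredundant s -> injective f ->
    f (nth 1 s 0) = nth 1 s 0 -> f (last 1 s) = last 1 s ->
    {in s, forall x, f x \in s} ->
    (forall i, i.+2 < size s ->
      f (nth 1 s i * nth 1 s i.+1) = f (nth 1 s i) * f (nth 1 s i.+1)) ->
    (forall i, i.+2 < size s ->
      f (nth 1 s i * nth 1 s i.+1) = (nth 1 s 0)^-1 \/
      exists2 k, k.+1 < size s &
        f (nth 1 s i * nth 1 s i.+1) = nth 1 s k * nth 1 s k.+1) ->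
  {in s, forall x, f x = x}.
Proof.
move=> us irr injf f0 fl fs fM fY x /(nthP 1)[n ns <-] {x}.
elim/ltn_ind: n ns => -[//|i] IH ltis.
(* The hypotheses on products skip the pair ending in the last entry; that entry is fixed by
   [fl]. *)
have [eqi | nei] := eqVneq i.+1 (size s).-1; first by rewrite eqi nth_last.
have lti2 : i.+2 < size s by rewrite ltn_neqAle ltis andbT; apply: contra nei => /eqP<-.
have lti := ltnW ltis.
have fi : f (nth 1 s i) = nth 1 s i by exact: IH.
have /(nthP 1)[j ltj fj] : f (nth 1 s i.+1) \in s by rewrite fs ?mem_nth.
have ji : nth 1 s i != nth 1 s j.
  by rewrite -fi fj (inj_eq injf) nth_uniq // neq_ltn ltnSn.
have := fY i lti2; rewrite fM // fi -fj.
case=> [eq0|[k ltk]].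
  have s0 : nth 1 s 0 \in s by rewrite mem_nth // (leq_trans _ lti).
  have /(_ (nth 1 s 0)^-1) := irredundant_mulN irr (mem_nth 1 lti) (mem_nth 1 ltj) s0 ji.
  by rewrite groupV cycle_id eq0 eqxx => /(_ isT).
have ltk' := ltnW ltk.
have M n : n < size s -> nth 1 s n \in s by exact: mem_nth.
case/(irredundant_mulI irr (M _ lti) (M _ ltj) (M _ ltk') (M _ ltk) ji).
  by case=> /eqP; rewrite nth_uniq // => /eqP->.
(* Here vertex [i.+1] would be sent back to the predecessor of [i], which by induction is already
   its own image. *)
case=> /eqP; rewrite nth_uniq // => /eqP eqik ejk.
have : f (nth 1 s i.+1) = f (nth 1 s k).
  by rewrite -fj ejk IH // eqik.
by move/injf/eqP; rewrite nth_uniq // eqik gtn_eqF ?leqnSn.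
Qed.

Lemma irredundant_invN (gT : finGroupType) (s : seq gT) (x y : gT) :
  irredundant s -> x \in s -> y \in s -> x^-1 = y -> x = y.
Proof.
move=> irr xs ys exy; apply/eqP; apply: contraT => xy.
have: y \in <<[set v in s] :\ x>> by rewrite mem_gen_others // eq_sym.
by rewrite -exy groupV (negPf (irr x xs)).
Qed.

(** * Fibers that encode both generating sequences *)

Definition consecutive_prods (gT : finGroupType) (s : seq gT) : {set gT} :=
  [set nth 1 s (k : nat) * nth 1 s k.+1 | k : 'I_(size s).-1].

Lemma consecutive_prodsP (gT : finGroupType) (s : seq gT) (x : gT) :
  reflect (exists2 k, k.+1 < size s & x = nth 1 s k * nth 1 s k.+1)
          (x \in consecutive_prods s).
Proof.
apply: (iffP imsetP) => [[k _ ->]|[k ltk ->]].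
  by exists k => //; rewrite -ltn_predRL.
by rewrite -ltn_predRL in ltk; exists (Ordinal ltk).
Qed.

(* Here s generates B and t generates A; t may be shorter than s, in which case
   nth pads it with 1. *)
Definition fiber (gT : finGroupType) (A : {set gT}) (s t : seq gT) (x : gT) :
    {set gT} :=
  if x \notin <<[set y in s] :\ last 1 s>> then
    if x == last 1 s then A else set0
  else if x == 1 then [set nth 1 t (size s).-1]
  else if x == nth 1 s 0 then A :\ nth 1 t 0
  else if x \in s then [set nth 1 t (index x s)]
  else if (x == (nth 1 s 0)^-1) || (x \in consecutive_prods s) then A :\ 1
  else set0.

Section Fiber.

Variables (gT : finGroupType) (A : {group gT}) (s t : seq gT).
Hypotheses (us : uniq s) (irr : irredundant s) (s_gt0 : 0 < size s).
Hypotheses (tA : {subset t <= A}) (t0 : nth 1 t 0 != 1) (ntA : A :!=: 1).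
Hypothesis t_small : #|A| = 2 -> size t <= 1.

Local Notation M := <<[set y in s] :\ last 1 s>>.
Local Notation F := (fiber A s t).

Let nth_tA i : nth 1 t i \in A.
Proof. by have [/(mem_nth 1)/tA|/(nth_default 1)->//] := ltnP i (size t). Qed.

Let lastE : nth 1 s (size s).-1 = last 1 s.
Proof. exact: nth_last. Qed.

Let last_s : last 1 s \in s.
Proof. by rewrite -lastE mem_nth // prednK. Qed.

Let nth_s i : i < size s -> nth 1 s i \in s.
Proof. exact: mem_nth. Qed.

Let cardA : 1 < #|A|.
Proof. by rewrite cardG_gt1. Qed.

Let cardD a : a \in A -> #|A :\ a| = #|A|.-1.
Proof. by move=> aA; rewrite (cardsD1 a A) aA. Qed.

Let nth_M i : i < (size s).-1 -> nth 1 s i \in M.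
Proof.
move=> lti; have lti' : i < size s by rewrite (leq_trans lti) ?leq_pred.
apply: mem_gen_others; first exact: nth_s.
by rewrite -lastE nth_uniq ?prednK // neq_ltn lti.
Qed.

Lemma fiber_last : F (last 1 s) = A.
Proof. by rewrite /fiber irr // eqxx. Qed.

(** The last entry of [s] has the full fiber and cannot single out a point of [A], so 1 carries the
    point with that index. *)
Lemma fiber1 : F 1 = [set nth 1 t (size s).-1].
Proof. by rewrite /fiber group1 eqxx. Qed.

Lemma fiber_head : 1 < size s -> F (nth 1 s 0) = A :\ nth 1 t 0.
Proof.
move=> s_gt1; rewrite /fiber nth_M ?ltn_predRL //= eqxx.
by rewrite (negPf (irredundant_neq1 irr _)) // nth_s.
Qed.

Lemma fiber_nth i : 0 < i < (size s).-1 -> F (nth 1 s i) = [set nth 1 t i].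
Proof.
case/andP=> i0 lti; have lti' : i < size s by rewrite (leq_trans lti) ?leq_pred.
rewrite /fiber nth_M //= (negPf (irredundant_neq1 irr (nth_s lti'))).
by rewrite nth_uniq // eqn0Ngt i0 nth_s // index_uniq.
Qed.

(** The bound leaves out the pair ending in the last entry: its product is outside [M] and has an
    empty fiber. *)
Lemma fiber_prod i : i.+2 < size s ->
  F (nth 1 s i * nth 1 s i.+1) = A :\ 1.
Proof.
move=> lti2; have lti1 := ltnW lti2; have lti := ltnW lti1.
have prodN z w : z \in s -> w \in <[z]> -> nth 1 s i * nth 1 s i.+1 != w.
  move=> zs wz; apply: (irredundant_mulN irr _ _ zs _ wz); rewrite ?nth_s //.
  by rewrite nth_uniq // neq_ltn ltnSn.
have prod_s : nth 1 s i * nth 1 s i.+1 \in consecutive_prods s.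
  by apply/consecutive_prodsP; exists i.
rewrite /fiber groupM ?nth_M ?ltn_predRL //=.
rewrite (negPf (prodN _ 1 last_s _)) // (negPf (prodN _ _ (nth_s s_gt0) _)) ?cycle_id //.
rewrite prod_s orbT ifN //; apply/negP => zs.
by have := prodN _ _ zs (cycle_id _); rewrite eqxx.
Qed.

(** By irredundance, an inverse of the head that is an entry is the head itself. This mark
    identifies the head when [#|A| = 2]. *)
Lemma fiber_head_inv : 1 < size s -> (nth 1 s 0)^-1 != nth 1 s 0 ->
  F (nth 1 s 0)^-1 = A :\ 1.
Proof.
move=> s_gt1 s0V; rewrite /fiber groupV nth_M ?ltn_predRL //=.
rewrite eq_invg1 (negPf (irredundant_neq1 irr _)) ?nth_s // (negPf s0V) eqxx /=.
rewrite ifN //; apply: contra s0V => s0Vs.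
exact/eqP/esym/(irredundant_invN irr (nth_s s_gt0) s0Vs erefl).
Qed.

Lemma fiber_eq_full x : F x = A -> x = last 1 s.
Proof.
have neq (U : {set gT}) : #|U| < #|A| -> U = A -> x = last 1 s.
  by move=> ltUA eqUA; rewrite eqUA ltnn in ltUA.
have ltD a : a \in A -> #|A :\ a| < #|A| by move=> aA; rewrite cardD // ltn_predL.
rewrite /fiber; case: ifP => _.
  by case: eqP => // _; apply: neq; rewrite cards0.
do 4![case: ifP => _; first by apply: neq; rewrite ?cards1 ?ltD].
by apply: neq; rewrite cards0.
Qed.

(** The size leaves only complements of a point, and containing 1 excludes [A :\ 1]. Both conditions
    survive an automorphism whose action on [A] is still unknown. *)
Lemma fiber_eq_head x :
  2 < #|A| -> #|F x| = #|A|.-1 -> 1 \in F x -> x = nth 1 s 0.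
Proof.
move=> A_gt2; rewrite /fiber; case: ifP => _.
  case: ifP => _ /eqP; last by rewrite inE.
  by rewrite gtn_eqF // ltn_predL cardG_gt0.
have neq1 : 1%N != #|A|.-1 by rewrite neq_ltn ltn_predRL A_gt2.
case: ifP => _; first by rewrite cards1 => /eqP; rewrite (negPf neq1).
case: ifP => [/eqP // | _].
case: ifP => _; first by rewrite cards1 => /eqP; rewrite (negPf neq1).
by case: ifP => _; rewrite !inE ?eqxx.
Qed.

(** When [#|A| = 2], the edge mark [A :\ 1] is also a singleton; the last condition excludes it. *)
Lemma fiber_eq_point x : x != 1 ->
  #|F x| = 1%N -> (#|A| = 2 -> 1 \in F x) -> x \in s.
Proof.
move=> x1; rewrite /fiber (negPf x1).
case: ifP => _.
  by case: ifP => [/eqP->//|_]; rewrite cards0.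
case: ifP => [/eqP->|_]; first by rewrite nth_s.
case: ifP => // _; case: ifP => _; rewrite ?cards0 // cardD // => A1.
have A2 : #|A| = 2 by rewrite -(prednK (cardG_gt0 A)) A1.
by rewrite !inE eqxx => /(_ A2).
Qed.

Lemma fiber_eq_edge x : x != 1 -> F x = A :\ 1 ->
  x = (nth 1 s 0)^-1 \/ x \in consecutive_prods s.
Proof.
move=> x1; rewrite /fiber (negPf x1).
have no1 (U : {set gT}) (P : Prop) : 1 \in U -> U = A :\ 1 -> P.
  by move=> U1 eqU; move: U1; rewrite eqU !inE eqxx.
have no0 : set0 != A :\ 1 by rewrite eq_sym -card_gt0 cardD // ltn_predRL.
case: ifP => _.
  case: ifP => _; first exact: no1.
  by move/eqP; rewrite (negPf no0).
case: ifP => [_ | xs0]; first by apply: no1; rewrite !inE eq_sym t0 group1.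
case: ifP => [xs | _].
  have ltx : 0 < index x s by rewrite lt0n; apply: contraFneq xs0 => <-; rewrite nth_index.
  (* If [#|A| = 2], then [t] has at most one entry, so at a positive index the point is the default
     1, which [A :\ 1] omits. Otherwise [A :\ 1] is not a singleton. *)
  have [A2 | A2] := eqVneq #|A| 2.
    apply: no1; rewrite inE nth_default //.
    exact: leq_trans (t_small A2) _.
  move/(congr1 (fun U : {set gT} => #|U|)); rewrite cards1 cardD // => A1.
  by case/eqP: A2; rewrite -(prednK (cardG_gt0 A)) -A1.
case: ifP => [/orP[/eqP->|->] | _]; [by left | by right |].
by move/eqP; rewrite (negPf no0).
Qed.

End Fiber.

(** * Rigidity of the fiber pattern *)

(** The order matters: [f] is shown to fix the last entry of [s], then the head, then all of [s] by
    [path_rigid]. Only over fixed elements of [B] do the fibers force [f] to fix the entries of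
    [t]. *)
Lemma fiber_rigid (gT : finGroupType) (G A B : {group gT}) (s t : seq gT)
    (f : {morphism G >-> gT}) :
    A \subset G -> B \subset G -> coprime #|A| #|B| -> A :!=: 1 -> B :!=: 1 ->
    uniq s -> irredundant s -> <<[set y in s]>> = B ->
    uniq t -> irredundant t -> <<[set y in t]>> = A -> size t <= size s ->
    injective f -> {in A, forall a, f a \in A} ->
    {in B, forall x, fiber A s t (f x) = f @: fiber A s t x} ->
  {in A, forall a, f a = a} /\ {in B, forall x, f x = x}.
Proof.
move=> sAG sBG coAB ntA ntB us irrs gens ut irrt gent le_ts injf fA fF.
have sB : {subset s <= B} by move=> x xs; rewrite -gens mem_gen // inE.
have tA : {subset t <= A} by move=> x xt; rewrite -gent mem_gen // inE.
have fn1 x : x \in B -> x != 1 -> f x != 1.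
  by move=> xB; apply: contra => /eqP fx; rewrite -(inj_eq injf) fx morph1.
have t_gt0 : 0 < size t.
  case: t gent {ut irrt le_ts tA fF} => // gent; case/eqP: ntA.
  by rewrite -gent; apply/trivgP; rewrite gen_subG; apply/subsetP=> x; rewrite inE.
have s_gt0 := leq_trans t_gt0 le_ts.
have t0 : nth 1 t 0 != 1 by apply: (irredundant_neq1 irrt); rewrite mem_nth.
have t_small : #|A| = 2 -> size t <= 1.
  move=> A2; have: #|[set y in t]| <= #|A :\ 1|.
    apply/subset_leq_card/subsetP => y; rewrite !inE => yt.
    by rewrite tA // (irredundant_neq1 irrt yt).
  by move: A2; rewrite cardsE (card_uniqP ut) (cardsD1 1 A) group1 add1n => -[->].
have nths i : i < size s -> nth 1 s i \in s by exact: mem_nth.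
have nthB i : i < size s -> nth 1 s i \in B by move=> lti; rewrite sB ?nths.
have fD a : f a = a -> f @: (A :\ a) = A :\ a.
  move=> fa; apply/eqP; rewrite eqEcard card_imset // leqnn andbT.
  apply/subsetP=> _ /imsetP[y /setD1P[ya yA] ->].
  by rewrite !inE fA // -{1}fa (inj_eq injf) ya.
have fl : f (last 1 s) = last 1 s.
  apply: (fiber_eq_full tA ntA).
  rewrite fF ?fiber_last // -?nth_last ?nthB ?prednK //.
  apply/eqP; rewrite eqEcard card_imset // leqnn andbT.
  by apply/subsetP=> _ /imsetP[y yA ->]; rewrite fA.
have fixed1 (x a : gT) : x \in B -> f x = x -> fiber A s t x = [set a] -> f a = a.
  move=> xB fx Fx; have := fF x xB; rewrite fx Fx imset_set1.
  by move/set1_inj.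
have tail_case i : 0 < i < (size s).-1 ->
    fiber A s t (f (nth 1 s i)) = [set f (nth 1 t i)].
  move=> lti; rewrite fF ?fiber_nth ?imset_set1 // nthB //.
  by case/andP: lti => _ lti; rewrite (leq_trans lti) ?leq_pred.
have f0 : f (nth 1 s 0) = nth 1 s 0.
  have [s_le1 | s_gt1] := leqP (size s) 1.
    have s1 : size s = 1%N by apply/eqP; rewrite eqn_leq s_le1.
    by move: fl; rewrite -nth_last s1.
  have Ff0 : fiber A s t (f (nth 1 s 0)) = f @: (A :\ nth 1 t 0).
    by rewrite fF ?fiber_head // nthB.
  have cardD0 : #|A :\ nth 1 t 0| = #|A|.-1.
    by rewrite (cardsD1 (nth 1 t 0) A) tA // mem_nth.
  have F1 : 1 \in fiber A s t (f (nth 1 s 0)).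
    by rewrite Ff0; apply/imsetP; exists 1; rewrite ?morph1 // !inE eq_sym t0 group1.
  have cardF : #|fiber A s t (f (nth 1 s 0))| = #|A|.-1.
    by rewrite Ff0 card_imset.
  have s0n1 : nth 1 s 0 != 1 by rewrite (irredundant_neq1 irrs) ?nths.
  have [A_gt2 | A_le2] := ltnP 2 #|A|; first exact: (fiber_eq_head A_gt2 cardF F1).
  have A2 : #|A| = 2 by apply/eqP; rewrite eqn_leq A_le2 cardG_gt1.
  have f0s : f (nth 1 s 0) \in s.
    apply: (fiber_eq_point (A := A) (t := t) s_gt0 (fn1 _ (nthB _ s_gt0) s0n1)) => //.
    by rewrite cardF A2.
  (* Otherwise the order of the head divides 2, the order of [A], and coprimality makes the head
     trivial. *)
  have s0V : (nth 1 s 0)^-1 != nth 1 s 0.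
    apply: contra s0n1 => /eqP s0V; rewrite -order_eq1.
    have s0_2 : #[nth 1 s 0] %| #|A|.
      by rewrite A2 order_dvdn expgS expg1 -{2}s0V mulgV.
    have := coprime_dvdl s0_2 (coprime_dvdr (order_dvdG (nthB _ s_gt0)) coAB).
    by rewrite /coprime gcdnn.
  have FV : fiber A s t (f (nth 1 s 0)^-1) = A :\ 1.
    by rewrite fF ?groupV ?nthB // fiber_head_inv // fD // morph1.
  (* The inverse of the image of the head is the inverse of the head or a product of consecutive
     entries. The latter is impossible, as that image is an entry by [f0s]. *)
  have := fiber_eq_edge t0 ntA t_small _ FV.
  rewrite fn1 ?groupV ?nthB ?eq_invg1 // => /(_ isT).
  rewrite morphV ?(subsetP sBG) ?nthB //.
  case=> [/invg_inj // | /consecutive_prodsP[k ltk eqk]].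
  have := @irredundant_mulN _ _ _ _ _ (f (nth 1 s 0))^-1 irrs (nths _ (ltnW ltk)) (nths _ ltk) f0s.
  by rewrite nth_uniq ?(ltnW ltk) // neq_ltn ltnSn groupV cycle_id eqk eqxx => /(_ isT isT).
have fs : {in s, forall x, f x \in s}.
  move=> x /(nthP 1)[i lti <-].
  have [-> | i_gt0] := posnP i; first by rewrite f0 nths.
  have [ilast | ltil] := leqP (size s).-1 i.
    suff -> : i = (size s).-1 by rewrite nth_last fl -nth_last nths ?prednK.
    by apply/eqP; rewrite eqn_leq ilast -ltnS prednK ?lti.
  have Fi : fiber A s t (f (nth 1 s i)) = [set f (nth 1 t i)].
    by apply: tail_case; rewrite i_gt0.
  apply: (fiber_eq_point (A := A) (t := t)) => //.
  - by rewrite fn1 ?nthB // (irredundant_neq1 irrs) ?nths.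
  - by rewrite Fi cards1.
  - move=> A2; rewrite Fi (nth_default 1) ?morph1 ?inE //.
    exact: leq_trans (t_small A2) _.
have fixs : {in s, forall x, f x = x}.
  apply: path_rigid => // i lti2; have lti1 := ltnW lti2; have lti := ltnW lti1.
    by rewrite morphM ?(subsetP sBG) ?nthB.
  have FY : fiber A s t (f (nth 1 s i * nth 1 s i.+1)) = A :\ 1.
    by rewrite fF ?groupM ?nthB // fiber_prod // fD // morph1.
  have ne1 : f (nth 1 s i * nth 1 s i.+1) != 1.
    rewrite fn1 ?groupM ?nthB //.
    rewrite (irredundant_mulN irrs (nths _ lti) (nths _ lti1) (nths _ lti)) //.
    by rewrite nth_uniq // neq_ltn ltnSn.
  case: (fiber_eq_edge t0 ntA t_small ne1 FY); first by left.
  by right; apply/consecutive_prodsP.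
have fixB : {in B, forall x, f x = x}.
  rewrite -gens; apply: eq_on_gen => [|x].
    by apply/subsetP => x; rewrite inE => xs; rewrite (subsetP sBG) ?sB.
  by rewrite inE; apply: fixs.
split=> //; rewrite -gent; apply: eq_on_gen => [|y].
  by apply/subsetP => y; rewrite inE => yt; rewrite (subsetP sAG) ?tA.
rewrite inE => /(nthP 1)[i ltit <-] {y}.
have lti := leq_trans ltit le_ts.
have [eqi | nei] := eqVneq i (size s).-1.
  by apply: (fixed1 1); rewrite ?morph1 // eqi fiber1.
have ltil : i < (size s).-1 by rewrite ltn_neqAle nei -ltnS prednK.
have s_gt1 : 1 < size s by rewrite -ltn_predRL (leq_ltn_trans _ ltil).
have [i0 | i_gt0] := posnP i; last first.
  by apply: (fixed1 (nth 1 s i)); rewrite ?nthB ?fixs ?nths // fiber_nth ?i_gt0.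
(* The fiber over the head omits only the first entry of [t]. If [f] moved that entry, its image
   would lie in the image of the fiber, against injectivity. *)
have := fF _ (nthB _ s_gt0); rewrite f0 fiber_head // i0 => eqD.
apply/eqP; apply: contraT => ft0.
have : f (nth 1 t 0) \in A :\ nth 1 t 0 by rewrite !inE ft0 fA // tA // mem_nth.
by rewrite eqD mem_imset // !inE eqxx.
Qed.

(** * Coprime direct products and nilpotent groups *)

Lemma coprime_dprod_char (gT : finGroupType) (G A B : {group gT}) :
  A \x B = G -> coprime #|A| #|B| -> A \char G.
Proof.
move=> defG coAB; have [nsAG _] := dprod_normal2 defG.
have hallA : Hall G A.
  rewrite /Hall normal_sub // -divgS ?normal_sub // -(dprod_card defG).
  by rewrite mulKn.
by rewrite -(normal_Hall_pcore (Hall_pi hallA) nsAG) pcore_char.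
Qed.

Lemma min_generating_seq (gT : finGroupType) (G : {group gT}) :
  exists s : seq gT,
    [/\ uniq s, irredundant s, <<[set y in s]>> = G & size s = 'm(G)].
Proof.
have [E genE cardEm] := grank_witness G; exists (enum E).
have setE : [set y in enum E] = E by apply/setP => y; rewrite inE mem_enum.
split; rewrite ?enum_uniq ?setE //; last by rewrite -cardE.
move=> x; rewrite mem_enum setE => xE; apply/negP => xgen.
have genE' : <<E :\ x>> = G.
  apply/eqP; rewrite eqEsubset -{1}genE genS ?subD1set //= -genE gen_subG.
  apply/subsetP => y yE; have [-> // | yx] := eqVneq y x.
  by rewrite mem_gen // !inE yx.
have := grank_min (E :\ x).
by rewrite genE' -cardEm (cardsD1 x E) xE ltnn.
Qed.

(** The inequality of ranks leaves a separate element of [B] to record each generator of [A]. *)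
Lemma coprime_dprod_not_detecting (gT : finGroupType) (G A B : {group gT}) :
    A \x B = G -> coprime #|A| #|B| -> A :!=: 1 -> B :!=: 1 -> 'm(A) <= 'm(B) ->
  ~ DRR_detecting G.
Proof.
move=> defG coAB ntA ntB le_m detG.
have [_ mulAB _ tiAB] := dprodP defG.
have [nsAG nsBG] := dprod_normal2 defG.
have [[sAG _] [sBG _]] := (andP nsAG, andP nsBG).
have charA := coprime_dprod_char defG coAB.
have charB : B \char G.
  by apply: (@coprime_dprod_char _ G B A); rewrite 1?dprodC 1?coprime_sym.
have [t [ut irrt gent sizet]] := min_generating_seq A.
have [s [us irrs gens sizes]] := min_generating_seq B.
pose S := [set g in G | divgr A B g \in fiber A s t (remgr A B g)].
have memS a x : a \in A -> x \in B -> (a * x \in S) = (a \in fiber A s t x).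
  move=> aA xB; rewrite inE divgrMid ?remgrMid //.
  by rewrite -mulAB mem_mulg.
have tA i : nth 1 t i \in A.
  have [lti | /(nth_default 1)->//] := ltnP i (size t).
  by rewrite -gent mem_gen // inE mem_nth.
have fibA x : fiber A s t x \subset A.
  rewrite /fiber; case: ifP => _; first by case: ifP; rewrite ?sub0set.
  do 4![case: ifP => _; first by rewrite ?sub1set ?subsetDl].
  exact: sub0set.
have sB : [set y in s] \subset B by rewrite -gens subset_gen.
have s_gt0 : 0 < size s.
  rewrite lt0n; apply: contra ntB => /nilP s0; rewrite -gens s0.
  by apply/eqP/trivgP; rewrite gen_subG; apply/subsetP => y; rewrite inE.
have last_s : last 1 s \in s by rewrite -nth_last mem_nth // prednK.
have autS : aut_set G S = 1.
  apply/setP => phi; rewrite inE [in RHS]inE.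
  apply/andP/eqP => [[phiG /eqP phiS] | ->]; last first.
    by rewrite group1 (eq_imset _ (@perm1 _)) imset_id.
  have phiM : {in G &, {morph phi : g h / g * h}} by apply/morphicP/Aut_morphic.
  have phi_char (C : {group gT}) : C \char G -> {in C, forall x, phi x \in C}.
    move=> /andP[_ /forall_inP/(_ phi phiG)/subsetP sub] x xC.
    by apply: sub; apply: imset_f.
  have [] // := @fiber_rigid _ G A B s t (autm_morphism phiG).
  - by rewrite sizet sizes.
  - by move=> x y /=; rewrite !autmE; apply: perm_inj.
  - by move=> a aA; rewrite /= autmE phi_char.
  (* Since [phi] preserves both factors, invariance of [S] can be read off fiber by fiber, comparing
     [A]- and [B]-components. *)
  - move=> x xB; rewrite /= autmE.
    have xG := subsetP sBG x xB; have phixB := phi_char B charB x xB.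
    apply/setP => a; apply/idP/imsetP => [aF | [b bF ->]].
      have aA := subsetP (fibA _) a aF.
      have: a * phi x \in phi @: S by rewrite phiS memS.
      case/imsetP=> g gS; have: g \in G by move: gS; rewrite inE => /andP[].
      rewrite -{1}mulAB => /mulsgP[b y bA yB eqg]; subst g.
      have [bG yG] := (subsetP sAG b bA, subsetP sBG y yB).
      have [phibA phiyB] := (phi_char A charA b bA, phi_char B charB y yB).
      rewrite phiM // => eqM.
      have eqx : x = y.
        apply: (@perm_inj _ phi).
        by rewrite -(remgrMid tiAB aA phixB) eqM remgrMid.
      exists b; first by rewrite eqx -memS.
      by rewrite -(divgrMid tiAB aA phixB) eqM divgrMid.
    have bA := subsetP (fibA _) b bF; have bG := subsetP sAG b bA.
    rewrite -memS ?phi_char // -phiM // -phiS imset_f //.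
    by rewrite memS.
  move=> fixA fixB; apply/(eq_Aut phiG (group1 _)) => g.
  rewrite -mulAB => /mulsgP[a x aA xB ->]; rewrite perm1.
  rewrite phiM ?(subsetP sAG a) ?(subsetP sBG x) //.
  by have := fixA a aA; have := fixB x xB; rewrite /= !autmE => -> ->.
have lastB : last 1 s \in B by rewrite (subsetP sB) // inE.
pose B0 := [group of <<[set y in s] :\ last 1 s>>].
have sB0B : B0 \subset B by rewrite gen_subG (subset_trans (subD1set _ _)).
have HE : A <*> B0 = A * B0.
  by have [_ _ cAB _] := dprodP defG; rewrite cent_joinEr // (subset_trans sB0B).
have sSG : S \subset G by apply/subsetP => g; rewrite inE => /andP[].
(* Outside [A * B0] the fibers are [A] or empty, so left multiplication by [A] preserves that part
   of [S]. *)
apply: (@wreath_not_DRR _ G (A <*> B0) A S) (detG S sSG autS) => //.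
- apply/properP; split; first by rewrite join_subG sAG (subset_trans sB0B).
  exists (last 1 s); first exact: (subsetP sBG).
  rewrite /= HE; apply: contra (irrs _ last_s) => /mulsgP[a x aA xB0 eqx].
  suff eqlast : x = last 1 s by rewrite -[X in X \in _]eqlast.
  rewrite -(remgrMid tiAB aA (subsetP sB0B x xB0)) -eqx.
  by rewrite -[in LHS](mul1g (last 1 s)) remgrMid.
- exact: joing_subl.
move=> g k /setDP[]; rewrite -{1}mulAB => /mulsgP[a x aA xB ->] gH kA.
have xB0 : x \notin B0 by apply: contra gH => xB0; rewrite /= HE mem_mulg.
rewrite mulgA !memS ?groupM // /fiber xB0.
by case: ifP => _; rewrite ?inE // groupMl.
Qed.

Theorem theorem1p10 (gT : finGroupType) (G : {group gT}) :
  nilpotent G -> DRR_detecting G -> exists2 p : nat, prime p & p.-group G.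
Proof.
move=> nilG detG.
(* [pdiv 1] is not prime, so the trivial group gets an arbitrary prime. *)
have [G1 | ntG] := eqVneq (G : {set gT}) 1.
  by exists 2 => //; rewrite G1 pgroup1.
pose p := pdiv #|G|; have pr_p : prime p by rewrite pdiv_prime // cardG_gt1.
exists p => //; apply: contraT => npG.
have defG := nilpotent_pcoreC p nilG.
have co : coprime #|'O_p(G)| #|'O_p^'(G)|.
  exact: pnat_coprime (pcore_pgroup _ _) (pcore_pgroup _ _).
have nt1 : 'O_p(G) :!=: 1.
  apply/eqP => O1; have: p^'.-group G.
    by rewrite -defG O1 dprod1g pcore_pgroup.
  by rewrite /pgroup p'natE // pdiv_dvd.
have nt2 : 'O_p^'(G) :!=: 1.
  by apply: contra npG => /eqP O1; rewrite -defG O1 dprodg1 pcore_pgroup.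
(* The factor needing fewer generators takes the role of [A]. *)
have [le_m | /ltnW le_m] := leqP 'm('O_p(G)) 'm('O_p^'(G)).
  by case: (coprime_dprod_not_detecting defG co nt1 nt2 le_m detG).
rewrite dprodC in defG; rewrite coprime_sym in co.
by case: (coprime_dprod_not_detecting defG co nt2 nt1 le_m detG).
Qed.
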